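(* (1) For every prime $p$, the function $\psi_p(X+Y;u)$ fails to converge as $u\to\infty$. (2) The function $\psi_2(X+2Y;u)$ fails to converge as $u\to\infty$. (Here $u$ ranges over positive integers.)
   Context: Let $\mathbb{N}_0$ be the set of non-negative integers. For a prime $p$, let $\mathrm{Pas}(p)=\{(m,n)\in\mathbb{N}_0\times\mathbb{N}_0 : m\ge n,\ \binom{m}{n}\not\equiv 0 \pmod p\}$ and $\theta_p=\log\frac{p(p+1)}{2}/\log p$. For a polynomial $P\in\{X+Y,\,X+2Y\}$ (of degree $1$) and a positive integer $u$, set $N_p(P;u)=\#\{(m,n)\in\mathrm{Pas}(p) : P(m,n)<u\}$ and $\psi_p(P;u)=N_p(P;u)/u^{\theta_p}$. *)

(* Defs.v *)
From HB Require Import structures.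
From mathcomp Require Import all_boot all_order all_algebra finmap.
From mathcomp Require Import all_classical all_reals all_analysis.
Set Implicit Arguments.
Unset Strict Implicit.
Unset Printing Implicit Defensive.
Import Order.TTheory GRing.Theory Num.Theory.
Import numFieldNormedType.Exports.
Local Open Scope classical_set_scope.
Local Open Scope ring_scope.

Definition Pas (p : nat) : set (nat * nat) :=
  [set mn | (mn.2 <= mn.1)%N /\ 'C(mn.1, mn.2) <> 0 %[mod p]].

(* Polynomials are represented by their evaluation maps on natural numbers. *)
Definition polyXY (m n : nat) : nat := (m + n)%N.
Definition polyX2Y (m n : nat) : nat := (m + 2 * n)%N.

Definition Pas_below (p : nat) (P : nat -> nat -> nat) (u : nat) :
    set (nat * nat) :=
  [set mn | Pas p mn /\ (P mn.1 mn.2 < u)%N].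

(* [fset_set] is the empty set on infinite sets; the lemmas
   [finite_Pas_below_XY] and [finite_Pas_below_X2Y] show that this default
   does not occur for the two polynomials above. *)
Definition countPas (p : nat) (P : nat -> nat -> nat) (u : nat) : nat :=
  #|` fset_set (Pas_below p P u)|%fset.

Definition theta (R : realType) (p : nat) : R :=
  ln ((p * p.+1)%:R / 2) / ln p%:R.

(* Both polynomials have degree 1, so the exponent of [u] is [theta R p].
   The value at [u = 0] is irrelevant to convergence along [\oo]. *)
Definition psi (R : realType) (p : nat) (P : nat -> nat -> nat) (u : nat) : R :=
  (countPas p P u)%:R / (u%:R `^ theta R p).

Lemma finite_Pas_below (p : nat) (P : nat -> nat -> nat) (u : nat) :
  (forall m n, (m + n <= P m n)%N) -> finite_set (Pas_below p P u).
Proof.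
move=> leP; apply: (@sub_finite_set _ _ (`I_u `*` `I_u)).
  move=> [m n] [_ /= Pu]; have h := leq_ltn_trans (leP m n) Pu.
  by split; [exact: leq_ltn_trans (leq_addr n m) h
            |exact: leq_ltn_trans (leq_addl m n) h].
by apply: finite_setX; exact: finite_II.
Qed.

Lemma finite_Pas_below_XY (p u : nat) : finite_set (Pas_below p polyXY u).
Proof. by apply: finite_Pas_below => m n. Qed.

Lemma finite_Pas_below_X2Y (p u : nat) : finite_set (Pas_below p polyX2Y u).
Proof.
by apply: finite_Pas_below => m n; rewrite /polyX2Y leq_add2l leq_pmull.
Qed.

(* Main.v *)
(** Write [N u] for the number of points of [Pas p] with [P < u].  By Lucas'
    theorem, [N (u * p)], [N (u * p - 1)], ... are fixed linear combinations of
    [N u], [N (u - 1)], ...; the corresponding matrix has dominant eigenvalue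
    [p (p + 1) / 2 = p ^ theta], and a left eigenvector for it gives a
    combination [G u] of [N u], [N (u - 1)], [N (u - 2)], of total weight [1],
    with [G (u * p) = p ^ theta * G u] exactly.  If [N u / u ^ theta] converges
    to [l], so does [G u / u ^ theta], which is constant along [u * p ^ k];
    hence [G u = l * u ^ theta] for all [u > 0], and so
    [G (u * v) * G 1 = G u * G v].  This fails for small [u = v].

    For [X + Y] and [p] odd, [u = v = 2] gives [2 a^2 = b^2] for positive
    integers, i.e. the irrationality of [sqrt 2] is contradicted; for [p = 2],
    [u = v = 3] gives [8 = 9] for [X + Y] and [128 = 121] for [X + 2 Y]. *)

Require Import Defs.
From mathcomp Require Import all_boot all_order all_algebra finmap.
From mathcomp Require Import zify ring lra.
From mathcomp Require Import all_classical all_reals all_analysis.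
Import Order.TTheory GRing.Theory Num.Theory.
Import numFieldNormedType.Exports.
Local Open Scope classical_set_scope.
Local Open Scope ring_scope.

(** * Binomials modulo [p]: splitting off the last base [p] digit *)

(** Pascal's rule, by induction on [m] and then [i]. Row [m.+1 * p] comes from row [m * p + p.-1];
    there the digit factors add up to ['C(p, j)], which vanishes modulo [p] for [0 < j < p]. *)
Lemma bin_lucas_digit p m n i j : prime p -> (i < p)%N -> (j < p)%N ->
  'C(m * p + i, n * p + j) = 'C(m, n) * 'C(i, j) %[mod p].
Proof.
move=> pp; have p0 := prime_gt0 pp.
elim: m n i j => [|m IHm] n i; elim: i n => [|i IHi] n j ip jp.
- rewrite mul0n addn0 !bin0n; case: j jp => [|j] jp; last first.
    by rewrite addnS muln0.
  by rewrite addn0 muln1 muln_eq0 (gtn_eqF p0) orbF.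
- case: n => [|n]; first by rewrite !mul0n !add0n bin0 mul1n.
  rewrite mul0n add0n bin_small; last by lia.
  by rewrite bin0n mul0n.
- have IH := fun n j => IHm n p.-1 j.
  have e : (m.+1 * p + 0 = (m * p + p.-1).+1)%N by lia.
  rewrite {}e; case: j jp => [|j] jp.
    case: n => [|n]; first by rewrite mul0n addn0 !bin0.
    have e : (n.+1 * p + 0 = (n * p + p.-1).+1)%N by lia.
    rewrite {1}e binS -e -modnDm !IH ?modnDm; try lia.
    by rewrite !bin0 binn !muln1 -binS.
  rewrite addnS binS -addnS -modnDm !IH ?modnDm; try lia.
  rewrite -mulnDr -binS prednK // bin0n muln0.
  by apply/eqP; rewrite mod0n; apply/dvdn_mull/prime_dvd_bin.
- rewrite addnS; case: j jp => [|j] jp.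
    case: n => [|n]; first by rewrite mul0n addn0 !bin0.
    have e : (n.+1 * p + 0 = (n * p + p.-1).+1)%N by lia.
    rewrite {1}e binS -e -modnDm !IHi ?modnDm; try lia.
    by rewrite !bin0 (@bin_small i p.-1) ?muln0 ?addn0 //; lia.
  rewrite addnS binS -addnS -modnDm (IHi n j.+1) ?(IHi n j) ?modnDm; try lia.
  by rewrite -mulnDr -binS.
Qed.

Lemma dvdn_bin_small p i j : prime p -> (i < p)%N ->
  (p %| 'C(i, j))%N = (i < j)%N.
Proof.
move=> pp ip; case: ltnP => [ij|ji]; first by rewrite bin_small ?dvdn0.
apply/negP => /(dvdn_mulr (j`! * (i - j)`!)); rewrite bin_fact //.
elim: i ip {ji} => [|i IHi] ip; first by rewrite fact0 Euclid_dvd1.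
by rewrite factS Euclid_dvdM // gtnNdvd //=; apply/IHi/ltnW.
Qed.

Lemma dvdn_bin_digit p m n i j : prime p -> (i < p)%N -> (j < p)%N ->
  (p %| 'C(m * p + i, n * p + j))%N = (p %| 'C(m, n))%N || (i < j)%N.
Proof.
move=> pp ip jp.
rewrite [LHS]/dvdn bin_lucas_digit // -[LHS]/(p %| _)%N Euclid_dvdM //.
by rewrite (dvdn_bin_small _ _ _ pp ip).
Qed.

(** * Counting points by their last digits *)

(** The inequality [n <= m] is implicit: ['C(m, n) = 0] is divisible by [p] when [m < n]. *)
Definition pas_lt p (P : nat -> nat -> nat) u (mn : nat * nat) :=
  ~~ (p %| 'C(mn.1, mn.2))%N && (P mn.1 mn.2 < u)%N.

Lemma countPas_count p P u K : (forall m n, (m + n <= P m n)%N) -> (u <= K)%N ->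
  countPas p P u =
  count (pas_lt p P u) [seq (m, n) | m <- iota 0 K, n <- iota 0 K].
Proof.
move=> leP uK; set s := [seq (m, n) | m <- iota 0 K, n <- iota 0 K].
have Us : uniq s.
  by apply: allpairs_uniq; rewrite ?iota_uniq // => -[? ?] [? ?] _ _ [-> ->].
rewrite /countPas; set A := Pas_below _ _ _.
have -> : fset_set A = [fset x in [seq x <- s | pas_lt p P u x]]%fset.
  apply/fsetP => -[m n]; rewrite in_fset_set; last exact: finite_Pas_below.
  rewrite inE /= mem_filter.
  apply/idP/idP => [/set_mem[[/= nm C0] Pu]|/andP[/andP[/= C0 Pu] _]].
    apply/andP; split.
      by rewrite /pas_lt /= Pu andbT; apply/eqP; rewrite -(mod0n p).
    have mn := leP m n; apply/allpairsP; exists (m, n).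
    by rewrite !mem_iota /=; split => //; lia.
  apply/mem_set; split => //; split => /=.
    by case: ltnP C0 => // ?; rewrite bin_small ?dvdn0.
  by apply/eqP; rewrite mod0n.
by rewrite card_fseq undup_id ?filter_uniq // size_filter.
Qed.

Lemma countPas_sum p P u K : (forall m n, (m + n <= P m n)%N) -> (u <= K)%N ->
  countPas p P u = (\sum_(0 <= m < K) \sum_(0 <= n < K) pas_lt p P u (m, n))%N.
Proof.
move=> leP uK; rewrite (countPas_count _ _ _ _ leP uK) -sum1_count big_mkcond.
rewrite big_allpairs /index_iota subn0; apply: eq_bigr => m _.
by apply: eq_bigr => n _; case: pas_lt.
Qed.

Lemma sum_digits (p K : nat) (F : nat -> nat) :
  (\sum_(0 <= m < K * p) F m =
   \sum_(i < p) \sum_(0 <= m < K) F (m * p + i))%N.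
Proof.
rewrite big_nat_mul exchange_big /=; apply: eq_bigr => m _.
rewrite mulSn -{1}[(m * p)%N]add0n big_addn addnK big_mkord.
by apply: eq_bigr => i _; rewrite addnC.
Qed.

(** Lucas restricts the last digits to [j <= i], and [P m n * p + P i j < u * p - t] amounts to
    [P m n < u - (P i j + t) %/ p]. Truncated subtraction is harmless: where it truncates, both
    inequalities fail. *)
Lemma countPas_digits p P u t : prime p ->
  (forall m n, (m + n <= P m n)%N) ->
  (forall m n i j, P (m * p + i) (n * p + j) = P m n * p + P i j)%N ->
  countPas p P (u * p - t) =
  (\sum_(i < p) \sum_(j < p | j <= i)
     countPas p P (u - (P i j + t) %/ p))%N.
Proof.
move=> pp leP Pdig; have p0 := prime_gt0 pp.
rewrite (countPas_sum _ _ _ (u * p)) //; last exact: leq_subr.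
rewrite sum_digits; apply: eq_bigr => i _.
under eq_bigr => m _ do rewrite sum_digits.
rewrite exchange_big /= [RHS]big_mkcond; apply: eq_bigr => j _.
case: leqP => [ji|ij]; last first.
  rewrite big1 // => m _; rewrite big1 // => n _.
  by rewrite /pas_lt /= dvdn_bin_digit // ij orbT.
rewrite (countPas_sum _ _ _ u) //; last exact: leq_subr.
apply: eq_bigr => m _; apply: eq_bigr => n _; congr nat_of_bool.
rewrite /pas_lt /= dvdn_bin_digit // ltnNge ji orbF Pdig; congr (_ && _).
by rewrite !ltn_subRL [in RHS]addnC -divnMDl // ltn_divLR // addnC addnA.
Qed.

(** * Asymptotics of self-similar functions *)

Lemma natr_powR_theta (R : realType) (p : nat) : (1 < p)%N ->
  p%:R `^ theta R p = (p * p.+1)%:R / 2.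
Proof.
move=> p1; have p0 : 0 < p%:R :> R by rewrite ltr0n ltnW.
have lnp : ln p%:R != 0 :> R by rewrite gt_eqF // ln_gt0 // ltr1n.
rewrite /powR gt_eqF // /theta divfK // lnK // posrE divr_gt0 // ltr0n.
by rewrite muln_gt0 ltnW.
Qed.

Lemma cvg_powR_pred_ratio (R : realType) (x : R) :
  (u%:R / u.+1%:R) `^ x @[u --> \oo] --> (1 : R).
Proof.
have h1 : (u%:R / u.+1%:R : R) @[u --> \oo] --> (1 : R).
  have -> : (fun u : nat => u%:R / u.+1%:R : R) = (fun u => 1 - harmonic u).
    by apply/funext => u; rewrite /harmonic /= -natr1; field; rewrite natr1 pnatr_eq0.
  rewrite -[X in _ --> X]subr0; apply: cvgB; [exact: cvg_cst|exact: cvg_harmonic].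
have h2 : x * ln (u%:R / u.+1%:R : R) @[u --> \oo] --> x * ln 1.
  by apply: cvgMr; apply: continuous_cvg h1; exact: continuous_ln.
rewrite ln1 mulr0 in h2; rewrite -[X in _ --> X]expR0.
apply: cvg_trans; last by apply: continuous_cvg h2; exact: continuous_expR.
(* At [u = 0] the base is [0], where [powR] is not given by the exponential formula. *)
apply: near_eq_cvg; near=> u.
have u0 : (0 < u)%N by near: u; exact: nbhs_infty_gt.
by rewrite /= /powR gt_eqF // divr_gt0 ?ltr0n.
Unshelve. all: by end_near. Qed.

Lemma cvg_pred_div_powR (R : realType) (x l : R) (f : nat -> R) :
  f u / u%:R `^ x @[u --> \oo] --> l -> f u.-1 / u%:R `^ x @[u --> \oo] --> l.
Proof.
move=> fl; rewrite -cvg_shiftS -[l]mulr1.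
apply: cvg_trans; last exact: cvgM fl (cvg_powR_pred_ratio R x).
apply: near_eq_cvg; near=> u.
have u0 : (0 < u)%N by near: u; exact: nbhs_infty_gt.
rewrite /= powRM ?invr_ge0 // mulrA divfK.
  by congr (_ * _); rewrite -powR_inv1 // -powRrM mulN1r powRN.
by rewrite gt_eqF // powR_gt0 // ltr0n.
Unshelve. all: by end_near. Qed.

Lemma self_similar_cvg (R : realType) (p : nat) (x l : R) (g : nat -> R) :
  (1 < p)%N ->
  (forall u, (0 < u)%N -> g (u * p)%N = p%:R `^ x * g u) ->
  g u / u%:R `^ x @[u --> \oo] --> l ->
  forall u, (0 < u)%N -> g u = l * u%:R `^ x.
Proof.
move=> p1 gp gl u u0; have p0 := ltnW p1.
have ux v : (0 < v)%N -> (v%:R : R) `^ x != 0.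
  by move=> v0; rewrite gt_eqF // powR_gt0 // ltr0n.
apply/(canRL (mulfVK (ux u u0))).
have sub : (u * p ^ k)%N @[k --> \oo] --> \oo.
  apply/cvgnyPge => A; near=> k.
  have Ak : (A <= k)%N by near: k; exact: nbhs_infty_ge.
  apply: leq_trans Ak (leq_trans (ltnW (ltn_expl k p1)) _).
  by rewrite leq_pmull.
have := cvg_comp _ _ sub gl.
have -> : (fun v : nat => g v / v%:R `^ x) \o (fun k => u * p ^ k)%N =
          (fun=> g u / u%:R `^ x).
  apply/funext; elim => [|k IHk] /=; first by rewrite muln1.
  have upk : (0 < u * p ^ k)%N by rewrite muln_gt0 u0 expn_gt0 p0.
  rewrite -IHk /= expnSr mulnA gp // natrM powRM ?ler0n //.
  by field; rewrite !ux.
by move/(cvg_lim (@Rhausdorff R)); rewrite lim_cst.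
Unshelve. all: by end_near. Qed.

(** Both sides equal [l ^+ 2 * (u * v) ^ x]; the unknown limit is thus eliminated, leaving an
    identity to test on small values. *)
Lemma self_similar_mult (R : realType) (p : nat) (x l : R) (g : nat -> R) :
  (1 < p)%N ->
  (forall u, (0 < u)%N -> g (u * p)%N = p%:R `^ x * g u) ->
  g u / u%:R `^ x @[u --> \oo] --> l ->
  forall u v, (0 < u)%N -> (0 < v)%N -> g (u * v)%N * g 1%N = g u * g v.
Proof.
move=> p1 gp gl u v u0 v0.
rewrite !(self_similar_cvg _ _ _ _ _ p1 gp gl) ?muln_gt0 ?u0 //.
by rewrite natrM powRM // powR1; ring.
Qed.

(** * Recurrences, eigenvectors and small values *)

(* For [t <= 1], the pairs [j <= i] of base [p] digits with [i + j + t < p]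
   contribute to [N (u * p - t)] a copy of [N u], the others [N (u - 1)]. *)
Definition digits_lt (p t : nat) : nat :=
  (\sum_(i < p) \sum_(j < p | j <= i) (i + j + t < p))%N.

Definition digits_ge (p t : nat) : nat :=
  (\sum_(i < p) \sum_(j < p | j <= i) (p <= i + j + t))%N.

(** For every [t] the two conditions partition the triangle [j <= i < p]. *)
Lemma digits_lt_ge p t : ((digits_lt p t + digits_ge p t) * 2 = p * p.+1)%N.
Proof.
rewrite -big_split /=; under eq_bigr => i _.
  rewrite -big_split /=; under eq_bigr => j _ do rewrite ltnNge addn_negb.
  rewrite -(big_ord_widen p (fun=> 1%N) (ltn_ord i)) sum_nat_const card_ord muln1.
over.
elim: p => [|p IHp]; first by rewrite big_ord0.
by rewrite big_ord_recr /= mulnDl IHp; lia.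
Qed.

Lemma digits_lt1_gt0 p : (1 < p)%N -> (0 < digits_lt p 1)%N.
Proof.
move=> p1; have p0 := ltnW p1; pose o := Ordinal p0.
by rewrite /digits_lt (bigD1 o) //= (bigD1 o) //= add0n p1.
Qed.

(** Since [i + j + t <= 2 * p - 1], the carry [(i + j + t) %/ p] is [0] or [1]. *)
Lemma countPas_XY_digits p u t : prime p -> (t <= 1)%N ->
  countPas p polyXY (u * p - t) =
  (digits_lt p t * countPas p polyXY u +
   digits_ge p t * countPas p polyXY u.-1)%N.
Proof.
move=> pp t1; have p0 := prime_gt0 pp.
rewrite countPas_digits //; last by move=> *; rewrite /polyXY; lia.
rewrite !big_distrl -big_split /=; apply: eq_bigr => i _.
rewrite !big_distrl -big_split /=; apply: eq_bigr => j _.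
rewrite /polyXY; case: ltnP => h.
  by rewrite divn_small // subn0 mul1n mul0n addn0.
have -> : ((i + j + t) %/ p = 1)%N; last by rewrite subn1 mul1n.
by apply/eqP; rewrite eqn_leq leq_divRL // mul1n h -ltnS ltn_divLR //;
  have := ltn_ord i; have := ltn_ord j; lia.
Qed.

(** The digit pairs [(0, 0)], [(1, 0)], [(1, 1)] give [X + 2 Y] the values [0], [1], [3]. *)
Lemma countPas_X2Y_digits u t :
  countPas 2 polyX2Y (u * 2 - t) =
  (countPas 2 polyX2Y (u - t %/ 2) + countPas 2 polyX2Y (u - t.+1 %/ 2) +
   countPas 2 polyX2Y (u - t.+3 %/ 2))%N.
Proof.
rewrite countPas_digits //; first last.
- by move=> *; rewrite /polyX2Y; lia.
- by move=> m n; rewrite /polyX2Y; lia.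
by do 3 rewrite ?big_mkcond ?big_ord_recr ?big_ord0 /=; rewrite !add0n !addn0 !addnA.
Qed.

(** For [m + n < 4] every nonzero ['C(m, n)] is [1] or [2], hence prime to [p]. *)
Lemma countPas_XY_small p u : (2 < p)%N -> (u <= 4)%N ->
  countPas p polyXY u = nth 0%N [:: 0; 1; 2; 4; 6]%N u.
Proof.
move=> p2 u4; have p1 := ltnW p2.
rewrite (countPas_count _ _ _ 4) //.
rewrite (@eq_in_count _ _ (fun mn => (mn.2 <= mn.1)%N && (mn.1 + mn.2 < u)%N)).
  by case: u u4 => [|[|[|[|[|u]]]]].
move=> [m n] _; rewrite /pas_lt /polyXY /=.
case: (ltnP _ u) => [mn|]; rewrite ?andbF ?andbT //.
move: (leq_trans mn u4) => {u u4 mn}.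
by move: m n => [|[|[|[|m]]]] [|[|[|[|n]]]] //= _; rewrite ?dvdn0 ?gtnNdvd.
Qed.

(** The rows [(digits_lt p t, digits_ge p t)], [t = 0, 1], both sum to the eigenvalue, so
    [(1 - k, k)] is a left eigenvector exactly when [(1 - k) * digits_ge p 0 = k * digits_lt p 1];
    this fixes [k]. *)
Lemma cvg_psi_XY_mult (R : realType) p (G : nat -> R) : prime p ->
  let k : R := (digits_ge p 0)%:R / (digits_lt p 1 + digits_ge p 0)%:R in
  let N u : R := (countPas p polyXY u)%:R in
  (forall u, G u = N u - k * (N u - N u.-1)) ->
  cvg (psi R p polyXY u @[u --> \oo]) ->
  forall u v, (0 < u)%N -> (0 < v)%N -> G (u * v)%N * G 1%N = G u * G v.
Proof.
move=> pp k N GE /cvg_ex[l Nl]; have p1 := prime_gt1 pp.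
apply: (self_similar_mult _ p (theta R p) l) => // [u u0|]; last first.
  have -> : (fun u => G u / u%:R `^ theta R p) = (fun u => N u / u%:R `^ theta R p
      - k * (N u / u%:R `^ theta R p - N u.-1 / u%:R `^ theta R p)).
    by apply/funext => u; rewrite GE; ring.
  have -> : l = l - k * (l - l) by rewrite subrr mulr0 subr0.
  have N1l := cvg_pred_div_powR _ _ _ _ Nl.
  by apply: cvgB => //; apply: cvgMr; apply: cvgB.
have d0 : (digits_lt p 1 + digits_ge p 0)%:R != 0 :> R.
  by rewrite pnatr_eq0 -lt0n ltn_addr // digits_lt1_gt0.
have e t : p%:R `^ theta R p = (digits_lt p t)%:R + (digits_ge p t)%:R.
  rewrite natr_powR_theta // -(digits_lt_ge p t) natrM -natrD.
  by rewrite mulfK // pnatr_eq0.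
rewrite !GE -subn1 /N countPas_XY_digits // -[(u * p)%N]subn0.
rewrite !countPas_XY_digits // /k !natrD !natrM (e 0%N).
have -> : (digits_ge p 1)%:R = p%:R `^ theta R p - (digits_lt p 1)%:R :> R.
  by rewrite (e 1%N); ring.
by rewrite (e 0%N); rewrite natrD in d0; field.
Qed.

(** Here the matrix has rows [(2, 1, 0)], [(1, 1, 1)], [(0, 2, 1)], and [(2, 2, 1)] is its left
    eigenvector for the eigenvalue [3]. *)
Lemma cvg_psi_X2Y_mult (R : realType) (G : nat -> R) :
  let N u : R := (countPas 2 polyX2Y u)%:R in
  (forall u, G u = (2 * N u + 2 * N u.-1 + N u.-2) / 5) ->
  cvg (psi R 2 polyX2Y u @[u --> \oo]) ->
  forall u v, (0 < u)%N -> (0 < v)%N -> G (u * v)%N * G 1%N = G u * G v.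
Proof.
move=> N GE /cvg_ex[l Nl].
apply: (self_similar_mult _ 2 (theta R 2) l) => // [u u0|]; last first.
  have -> : (fun u => G u / u%:R `^ theta R 2) = (fun u =>
      (2 * (N u / u%:R `^ theta R 2) + 2 * (N u.-1 / u%:R `^ theta R 2)
       + N u.-2 / u%:R `^ theta R 2) * 5^-1).
    by apply/funext => u; rewrite GE; ring.
  have -> : l = (2 * l + 2 * l + l) * 5^-1 by field.
  have N1l := cvg_pred_div_powR _ _ _ _ Nl.
  have N2l := cvg_pred_div_powR _ _ _ (N \o predn) N1l.
  by apply: cvgMl; apply: cvgD => //; apply: cvgD; apply: cvgMr.
rewrite !GE natr_powR_theta // -subn2 -subn1 /N.
rewrite !countPas_X2Y_digits -[(u * 2)%N]subn0 countPas_X2Y_digits.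
rewrite /= !subn0 -!subn1 -subnDA !natrD.
by field.
Qed.

Lemma countPas2_XY_small u : (u <= 9)%N ->
  countPas 2 polyXY u = nth 0%N [:: 0; 1; 2; 4; 5; 8; 10; 13; 14; 18]%N u.
Proof.
move=> u9; rewrite (countPas_count _ _ _ 9) //.
by do 10 (case: u u9 => [|u] u9; first by vm_compute).
Qed.

Lemma countPas2_X2Y_small u : (u <= 9)%N ->
  countPas 2 polyX2Y u = nth 0%N [:: 0; 1; 2; 3; 5; 6; 8; 10; 13; 14]%N u.
Proof.
move=> u9; rewrite (countPas_count _ _ _ 9) //; last first.
  by move=> m n; rewrite /polyX2Y; lia.
by do 10 (case: u u9 => [|u] u9; first by vm_compute).
Qed.

(** The 2-adic valuation is odd on the left and even on the right. *)
Lemma double_sqr_neq (m n : nat) : (0 < m)%N -> (2 * m ^ 2 <> n ^ 2)%N.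
Proof.
move=> m0 /(congr1 (odd \o logn 2)) /=.
by rewrite lognM ?expn_gt0 ?m0 // !lognX !mul2n !oddD !odd_double.
Qed.

Theorem theorem1p4 (R : realType) :
  (forall p : nat, prime p -> ~ cvg (psi R p polyXY u @[u --> \oo])) /\
  ~ cvg (psi R 2 polyX2Y u @[u --> \oo]).
Proof.
split=> [p pp|].
  pose k : R := (digits_ge p 0)%:R / (digits_lt p 1 + digits_ge p 0)%:R.
  pose N u : R := (countPas p polyXY u)%:R.
  move/(@cvg_psi_XY_mult _ _ (fun u => N u - k * (N u - N u.-1)) pp (fun=> erefl)).
  have [p2|] := ltnP 2 p; last first.
    move=> p2; have {p2} pE : p = 2%N by apply/eqP; rewrite eqn_leq p2 prime_gt1.
    have lt1 : digits_lt 2 1 = 1%N.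
      by rewrite /digits_lt; do 3 rewrite ?big_mkcond ?big_ord_recr ?big_ord0 /=.
    have ge1 : digits_ge 2 0 = 1%N.
      by rewrite /digits_ge; do 3 rewrite ?big_mkcond ?big_ord_recr ?big_ord0 /=.
    (* Now [k = 1/2], so [G 1 = 1/2], [G 3 = 3] and [G 9 = 16]. *)
    move=> /(_ 3 3 isT isT); rewrite /k /N pE lt1 ge1 addn1 !countPas2_XY_small //=.
    by clear => e; lra.
  move=> /(_ 2 2 isT isT); rewrite /N !countPas_XY_small //= => kE.
  have a0 := digits_lt1_gt0 _ (prime_gt1 pp).
  apply: (double_sqr_neq _ (digits_ge p 0) a0); apply/eqP.
  rewrite -(eqr_nat R) natrM !natrX; apply/eqP.
  have d0 : (digits_lt p 1)%:R + (digits_ge p 0)%:R != 0 :> R.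
    by rewrite -natrD pnatr_eq0 -lt0n ltn_addr.
  have kd : k * ((digits_lt p 1)%:R + (digits_ge p 0)%:R) = (digits_ge p 0)%:R.
    by rewrite /k natrD divfK.
  (* [kE] reads [(6 - 2 k) (1 - k) = (2 - k)^2], i.e. [(2 - k)^2 = 2]. *)
  move: kd kE; clear; move: (digits_lt p 1)%:R (digits_ge p 0)%:R k => a b k kd kE.
  have q : 2 - 4 * k + k ^+ 2 = 0 by lra.
  (* As [a] and [b] are the fractions [1 - k] and [k] of [a + b], the difference [2 a^2 - b^2] is
     [(a + b)^2 (2 - 4 k + k^2) = 0]. *)
  have ea : a = (1 - k) * (a + b) by rewrite mulrBl kd; ring.
  apply/eqP; rewrite -subr_eq0 -{1}kd {1}ea; apply/eqP.
  by rewrite -[RHS](mulr0 ((a + b) ^+ 2)) -q; ring.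
(* Here [G 1 = 2/5], [G 3 = 11/5] and [G 9 = 64/5]. *)
move/(@cvg_psi_X2Y_mult _ _ (fun=> erefl)) => /(_ 3 3 isT isT).
rewrite !countPas2_X2Y_small //= => e; lra.
Qed.
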